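(* Let $X$ be a Banach space, $T:X\rightrightarrows X^*$ and $K:X\rightrightarrows X$ set-valued maps. Suppose that $K$ is locally reproducible at a fixed point $z\in FP(K)$ with an open neighbourhood of reproducibility $U_z$. Then each element $\bar x$ of $LSVI(T,K(z)\cap U_z)$ belongs to $LSQVI(T,K)$. As a consequence, if $K$ is locally reproducible at every $z\in FP(K)$, with an open neighbourhood of reproducibility $U_z$ at each such $z$, then $$LSQVI(T,K)=\bigcup_{z\in FP(K)}LSVI(T,K(z)\cap U_z).$$
   Context: $FP(K)=\{x\in X: x\in K(x)\}$; $\langle\cdot,\cdot\rangle$ is the duality pairing on $X^*\times X$. A neighbourhood of a point is any set containing an open set that contains the point. $K$ is locally reproducible at $z\in FP(K)$ if there is a neighbourhood $U$ of $z$ such that $K(z)\cap U=K(u)\cap U$ for every $u\in K(z)\cap U$; such a $U$ is called a neighbourhood of reproducibility at $z$. $LSVI(T,C)$, for $C\subset X$: the set of $\bar x\in C$ for which there are a neighbourhood $U$ of $\bar x$ and $\bar x^*\in T(\bar x)$ with $\langle\bar x^*,y-\bar x\rangle\ge0$ for all $y\in C\cap U$. $LSQVI(T,K)$: the set of $\bar x\in X$ with $\bar x\in K(\bar x)$ for which there are a neighbourhood $U$ of $\bar x$ and $\bar x^*\in T(\bar x)$ with $\langle\bar x^*,y-\bar x\rangle\ge0$ for all $y\in K(\bar x)\cap U$. *)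

(* Defs.v *)
From HB Require Import structures.
From mathcomp Require Import all_boot all_order all_algebra.
From mathcomp Require Import boolp classical_sets reals topology normedtype.

Set Implicit Arguments.
Unset Strict Implicit.
Unset Printing Implicit Defensive.

Import Order.TTheory GRing.Theory Num.Theory.
Import numFieldNormedType.Exports.

Local Open Scope classical_set_scope.
Local Open Scope ring_scope.

(* The topological dual X^*: continuous linear functionals on X.  Only the
   underlying set and the pairing are used, so it carries no norm here. *)
Record dual (R : realType) (X : normedModType R) := Dual {
  dual_fun : {linear X -> R^o};
  dual_continuous : continuous dual_fun
}.

Definition pairing (R : realType) (X : normedModType R)
    (xs : dual X) (x : X) : R := dual_fun xs x.

Notation "'<|' xs , x '|>'" := (pairing xs x)
  (at level 0, xs at level 99, x at level 99, format "'<|' xs ,  x '|>'").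

Section QuasiVariational.
Context {R : realType} {X : normedModType R}.
Implicit Types (T : X -> set (dual X)) (K : X -> set X) (C U : set X).

Definition FP K : set X := [set x | K x x].

Definition reproducibility_nbhs K (z : X) U : Prop :=
  nbhs z U /\ forall u, (K z `&` U) u -> K z `&` U = K u `&` U.

Definition LSVI T C : set X :=
  [set x | C x /\ exists U, nbhs x U /\
    exists xs, T x xs /\ forall y, (C `&` U) y -> 0 <= <| xs, y - x |>].

Definition LSQVI T K : set X :=
  [set x | K x x /\ exists U, nbhs x U /\
    exists xs, T x xs /\ forall y, (K x `&` U) y -> 0 <= <| xs, y - x |>].

End QuasiVariational.

(* Main.v *)
Require Import Defs.
From HB Require Import structures.
From mathcomp Require Import all_boot all_order all_algebra.
From mathcomp Require Import boolp classical_sets reals topology normedtype.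

Set Implicit Arguments.
Unset Strict Implicit.
Unset Printing Implicit Defensive.

Import Order.TTheory GRing.Theory Num.Theory.
Import numFieldNormedType.Exports.

Local Open Scope classical_set_scope.
Local Open Scope ring_scope.

(** If [x] lies in [K z]&[Uz], reproducibility makes [K x] and [K z] agree on [Uz]. Both problems
    are local, so a solution over [K z]&[Uz] solves the quasi-variational inequality at [x] once its
    neighbourhood is shrunk into [Uz]. Conversely, a quasi-solution [x] is itself a fixed point, and
    cutting [K x] down to [U x] only weakens the inequality. *)

Theorem proposition3p4 (R : realType) (X : completeNormedModType R)
    (T : X -> set (dual X)) (K : X -> set X) :
  (forall (z : X) (Uz : set X),
      FP K z -> open Uz -> reproducibility_nbhs K z Uz ->
      forall x : X, LSVI T (K z `&` Uz) x -> LSQVI T K x) /\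
  (forall U : X -> set X,
      (forall z, FP K z -> open (U z) /\ reproducibility_nbhs K z (U z)) ->
      LSQVI T K = \bigcup_(z in FP K) LSVI T (K z `&` U z)).
Proof.
have sub (z : X) (Uz : set X) : open Uz -> reproducibility_nbhs K z Uz ->
    LSVI T (K z `&` Uz) `<=` LSQVI T K.
  move=> oU [_ repr] x [KUx [V [Vx [xs [Txs xs_ge0]]]]].
  have eqK := repr x KUx.
  split; first by move: KUx; rewrite eqK => -[].
  (* Inside [Uz] the constraint sets [K x] and [K z] coincide. Openness of [Uz] makes it a
     neighbourhood of [x], not just of [z]. *)
  exists (V `&` Uz); split.
    by apply: filterI => //; apply: open_nbhs_nbhs; split => //; case: KUx.
  exists xs; split=> // y [Kxy [Vy Uy]].
  by apply: xs_ge0; rewrite eqK.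
split=> [z Uz _ oU rU x|U HU]; first exact: sub.
apply/seteqP; split=> [x [Kxx [V [Vx [xs [Txs xs_ge0]]]]]|x [z /HU[oU rU]]].
  (* The index of the union is the solution [x] itself; it lies in [U x] because a neighbourhood
     contains its point. *)
  exists x => //; split.
    by split=> //; have [_ [/nbhs_singleton]] := HU x Kxx.
  exists V; split=> //; exists xs; split=> // y [[Kxy _] Vy].
  exact: xs_ge0.
exact: sub.
Qed.
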